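(* Let $G$ be a $\flat$-separated paratopological group and let $H$ be a normal subgroup of $G$. Endow $G/H$ with the quotient topology. Then: (1) the paratopological group $G/H$ is $\flat$-separated if and only if $H$ is closed in $G^\flat$; (2) if $G$ is $\flat$-regular and the set $H$ is locally compact in $G^\flat$ (i.e. locally compact in the subspace topology inherited from $G^\flat$), then $G/H$ is $\flat$-regular.
   Context: A paratopological group is a group $G$ endowed with a topology $\tau$ making the group operation $G\times G\to G$ continuous (inversion need not be continuous). For a normal subgroup $H$ of $G$, the quotient group $G/H$ with the quotient topology is again a paratopological group. The group reflexion $G^\flat=(G,\tau^\flat)$ of a paratopological group $(G,\tau)$ is the group $G$ endowed with the strongest topology $\tau^\flat\subset\tau$ turning $G$ into a topological group (not necessarily Hausdorff). Equivalently, $\tau^\flat$ is the unique topology on $G$ such that $(G,\tau^\flat)$ is a topological group, the identity map $(G,\tau)\to(G,\tau^\flat)$ is continuous, and every continuous homomorphism from $(G,\tau)$ into a topological group is also continuous on $(G,\tau^\flat)$. A subset of a paratopological group $(G,\tau)$ is $\flat$-closed if it is closed in the topology $\tau^\flat$. A paratopological group $(G,\tau)$ is $\flat$-separated if $\tau^\flat$ is Hausdorff, and $\flat$-regular if it has a neighborhood base (with respect to $\tau$) at the neutral element consisting of $\flat$-closed sets. *)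

(* Defs.v *)
From HB Require Import structures.
From mathcomp Require Import all_boot all_classical topology.

Set Implicit Arguments.
Unset Strict Implicit.
Unset Printing Implicit Defensive.

Local Open Scope classical_set_scope.
Local Open Scope quotient_scope.
Local Open Scope group_scope.

HB.structure Definition PreTopologicalGroup :=
  {G of Group G & Topological G}.

HB.mixin Record PreTopologicalGroup_isParatopological G
    of PreTopologicalGroup G := {
  mulg_continuous : continuous (fun p : G * G => p.1 * p.2)
}.

#[short(type="paratopologicalGroupType")]
HB.structure Definition ParatopologicalGroup :=
  {G of PreTopologicalGroup G & PreTopologicalGroup_isParatopological G}.

HB.mixin Record Paratopological_isTopologicalGroup G
    of ParatopologicalGroup G := {
  invg_continuous : continuous (fun x : G => x^-1)
}.

#[short(type="topologicalGroupType")]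
HB.structure Definition TopologicalGroup :=
  {G of ParatopologicalGroup G & Paratopological_isTopologicalGroup G}.

(* [t] ranges over the topologies on the carrier of [G]; the group law is
   always the one of [G]. *)
Definition is_group_topology (G : groupType) (t : Topological G) : Prop :=
  let Gt : topologicalType := Topological.Pack t in
  continuous ((fun p : G * G => p.1 * p.2) : Gt * Gt -> Gt) /\
  continuous ((fun x : G => x^-1) : Gt -> Gt).

Definition coarser_topology (T : topologicalType) (t : Topological T) : Prop :=
  forall U : set T, @open (Topological.Pack t) U -> open U.

Definition flat_index (G : paratopologicalGroupType) : Type :=
  {t : Topological G | is_group_topology t /\ coarser_topology t}.

(* The group reflexion: group topologies are stable under suprema, so that the
   supremum of all group topologies contained in the topology of [G] is the
   strongest of them; see [flat_coarser], [flat_strongest], [flat_universal]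
   and the [topologicalGroupType] structure below. *)
Definition flat (G : paratopologicalGroupType) : Type :=
  sup_topology (fun i : flat_index G => sval i).

HB.instance Definition _ (G : paratopologicalGroupType) := Group.copy (flat G) G.
HB.instance Definition _ (G : paratopologicalGroupType) :=
  Topological.copy (flat G) (sup_topology (fun i : flat_index G => sval i)).

Section FlatTheory.
Variable G : paratopologicalGroupType.

Let TS (i : flat_index G) : topologicalType := Topological.Pack (sval i).

Let cvg_TS (i : flat_index G) (x : flat G) :
  nbhs x --> (x : TS i).
Proof. by apply: (proj1 (@cvg_sup G _ (fun i => sval i) (nbhs x) x _)). Qed.

Let cvg_flat (F : set_system (flat G)) (x : flat G) :
  Filter F -> (forall i, F --> (x : TS i)) -> F --> x.
Proof.
move=> FF h; exact: (proj2 (@cvg_sup G _ (fun i => sval i) F x FF) h).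
Qed.

Lemma flat_mulg_continuous :
  continuous (fun p : flat G * flat G => p.1 * p.2).
Proof.
move=> [x y]; apply: cvg_flat => i.
have [[mc _] _] := svalP i.
move=> A /(mc (x, y)) [[B C] /= [nB nC] sBC].
by exists (B, C) => //; split; exact: (@cvg_TS i).
Qed.

Lemma flat_invg_continuous : continuous (fun x : flat G => x^-1).
Proof.
move=> x.
apply: (cvg_flat (@fmap_filter (flat G) (flat G) _ _ (@nbhs_filter (flat G) x))).
move=> i; have [[_ ic] _] := svalP i.
by move=> A /(ic x) nA; exact: (@cvg_TS i).
Qed.

Lemma flat_coarser (U : set G) : open (U : set (flat G)) -> open U.
Proof.
move=> oU; suff cf (x : G) : nbhs x --> (x : flat G).
  rewrite openE => x Ux; apply: cf; exact: (@open_nbhs_nbhs (flat G)).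
apply: cvg_flat => i A.
have [_ ci] := svalP i.
rewrite (@nbhsE (TS i)) => -[B [oB Bx] BA].
by apply: filterS BA _; apply: open_nbhs_nbhs; split => //; exact: ci.
Qed.

Lemma flat_strongest (t : Topological G) :
    is_group_topology t -> coarser_topology t ->
  forall U : set G, @open (Topological.Pack t) U -> open (U : set (flat G)).
Proof.
move=> gt ct U; rewrite openE => oU; rewrite openE => x /oU.
pose i : flat_index G := exist _ t (conj gt ct).
exact: (@cvg_TS i).
Qed.

End FlatTheory.

HB.instance Definition _ (G : paratopologicalGroupType) :=
  PreTopologicalGroup_isParatopological.Build (flat G)
    (@flat_mulg_continuous G).
HB.instance Definition _ (G : paratopologicalGroupType) :=
  Paratopological_isTopologicalGroup.Build (flat G) (@flat_invg_continuous G).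

Lemma flat_universal (G : paratopologicalGroupType) (K : topologicalGroupType)
    (f : {multiplicative G -> K}) :
  continuous f -> continuous (f : flat G -> K).
Proof.
move=> cf; apply/continuousP => A oA.
pose t : Topological G := Topological.on (initial_topology f).
have fi : continuous (f : initial_topology f -> K).
  exact: initial_continuous.
have key (Z : topologicalType) (g : Z -> G) :
    continuous (f \o g) -> continuous (g : Z -> initial_topology f).
  by move=> fg; apply/continuous_comp_initial.
pose I : topologicalType := initial_topology f.
have f1 : continuous (fun p : I * I => f p.1).
  by move=> p; apply: (continuous_comp (f := fst) (g := f : I -> K));
    [exact: cvg_fst|exact: fi].
have f2 : continuous (fun p : I * I => f p.2).
  by move=> p; apply: (continuous_comp (f := snd) (g := f : I -> K));
    [exact: cvg_snd|exact: fi].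
have fM : continuous (fun p : I * I => f p.1 * f p.2).
  move=> p; apply: (continuous_comp (f := fun p : I * I => (f p.1, f p.2))
    (g := fun q : K * K => q.1 * q.2)); last exact: mulg_continuous.
  by apply: cvg_pair; [exact: f1|exact: f2].
have fV : continuous (fun x : I => (f x)^-1).
  move=> x; apply: (continuous_comp (f := f : I -> K)
    (g := fun y : K => y^-1)); [exact: fi|exact: invg_continuous].
have gt : is_group_topology t.
  split.
    apply: (key (I * I)%type); rewrite (_ : _ \o _ = fun p => f p.1 * f p.2) //.
    by apply/funext => p /=; rewrite gmulfM.
  apply: (key I); rewrite (_ : _ \o _ = fun x => (f x)^-1) //.
  apply/funext => x /=; apply: (mulIg (f x)); rewrite -gmulfM !mulVg.
  by apply: (mulIg (f 1)); rewrite -gmulfM !mul1g.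
have ct : coarser_topology t.
  by move=> _ [B oB <-]; move/continuousP: cf; apply.
by apply: (flat_strongest gt ct); exists A.
Qed.

Definition flat_closed (G : paratopologicalGroupType) (A : set G) : Prop :=
  closed (A : set (flat G)).

Definition flat_separated (G : paratopologicalGroupType) : Prop :=
  hausdorff_space (flat G).

Definition flat_regular (G : paratopologicalGroupType) : Prop :=
  exists B : set_system G,
    (forall V, B V -> flat_closed V) /\ nbhs (1 : G) = filter_from B id.

(* Local compactness of the subspace [A] of [flat G]. Note that
   [locally_compact A] in [flat G] would be a weaker condition: it does not
   require the compact sets involved to be contained in [A]. *)
Definition flat_locally_compact (G : paratopologicalGroupType) (A : set G) :
  Prop := locally_compact [set: set_type (A : set (flat G))].

HB.mixin Record isConjClosed (G : groupType) (S : {pred G}) := {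
  gpredJr : {in S, forall x y, x ^ y \in S}
}.

#[short(type="normalClosed")]
HB.structure Definition NormalClosed (G : groupType) :=
  {S of GroupClosed G S & isConjClosed G S}.

Section Coset.
Variables (G : groupType) (H : normalClosed G).

Definition coset_rel : rel G := fun x y => x^-1 * y \in H.

Lemma coset_rel_equiv : equiv_class_of coset_rel.
Proof.
split=> [x|x y|y x z]; rewrite /coset_rel.
- by rewrite mulVg gpred1.
- by rewrite -gpredV invgM invgK.
- by move=> xy yz; rewrite -[z](mulVKg y) mulgA gpredM.
Qed.

Canonical coset_rel_equivRel := EquivRelPack coset_rel_equiv.

Lemma coset_relM x x' y y' :
  coset_rel x x' -> coset_rel y y' -> coset_rel (x * y) (x' * y').
Proof.
rewrite /coset_rel => xx yy.
have -> : (x * y)^-1 * (x' * y') = (x^-1 * x') ^ y * (y^-1 * y').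
  by rewrite /conjg invgM !mulgA mulgK.
by rewrite gpredM // gpredJr.
Qed.

Lemma coset_relV x x' : coset_rel x x' -> coset_rel x^-1 x'^-1.
Proof.
rewrite /coset_rel invgK => xx.
have -> : x * x'^-1 = ((x^-1 * x')^-1) ^ x^-1.
  by rewrite /conjg invgM !invgK !mulgA mulgK.
by rewrite gpredJr // gpredV.
Qed.

End Coset.

Definition quotient_group (G : paratopologicalGroupType) (H : normalClosed G) :
  Type := quotient_topology {eq_quot (coset_rel H)}.

Section QuotientGroup.
Variables (G : paratopologicalGroupType) (H : normalClosed G).
Local Notation Q := (quotient_group H).

HB.instance Definition _ :=
  Quotient.copy Q (quotient_topology {eq_quot (coset_rel H)}).
HB.instance Definition _ :=
  Topological.copy Q (quotient_topology {eq_quot (coset_rel H)}).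

Definition quotient_mul (x y : Q) : Q := \pi_Q (repr x * repr y).
Definition quotient_one : Q := \pi_Q 1.
Definition quotient_inv (x : Q) : Q := \pi_Q (repr x)^-1.

Let eq_pi (x y : G) : coset_rel H x y -> \pi_Q x = \pi_Q y.
Proof. by move=> xy; apply/eqmodP. Qed.

Let repr_pi (x : G) : coset_rel H (repr (\pi_Q x)) x.
Proof. by apply/eqmodP; rewrite reprK. Qed.

Lemma pi_quotient_mul (x y : G) :
  \pi_Q (x * y) = quotient_mul (\pi_Q x) (\pi_Q y).
Proof. by apply/esym/eq_pi/coset_relM; exact: repr_pi. Qed.

Lemma pi_quotient_inv (x : G) : \pi_Q x^-1 = quotient_inv (\pi_Q x).
Proof. by apply/esym/eq_pi/coset_relV; exact: repr_pi. Qed.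

Let quotient_mulA : associative quotient_mul.
Proof.
elim/quotW => x; elim/quotW => y; elim/quotW => z.
by rewrite -(pi_quotient_mul y z) -(pi_quotient_mul x y) -(pi_quotient_mul x)
  -(pi_quotient_mul _ z) mulgA.
Qed.

Let quotient_mul1g : left_id quotient_one quotient_mul.
Proof. by elim/quotW => x; rewrite -(pi_quotient_mul 1 x) mul1g. Qed.

Let quotient_mulg1 : right_id quotient_one quotient_mul.
Proof. by elim/quotW => x; rewrite -(pi_quotient_mul x 1) mulg1. Qed.

Let quotient_mulVg : left_inverse quotient_one quotient_inv quotient_mul.
Proof.
by elim/quotW => x; rewrite -pi_quotient_inv -(pi_quotient_mul x^-1 x) mulVg.
Qed.

Let quotient_mulgV : right_inverse quotient_one quotient_inv quotient_mul.
Proof.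
by elim/quotW => x; rewrite -pi_quotient_inv -(pi_quotient_mul x x^-1) mulgV.
Qed.

HB.instance Definition _ := isGroup.Build Q quotient_mulA quotient_mul1g
  quotient_mulg1 quotient_mulVg quotient_mulgV.

Lemma pi_mulg (x y : G) : \pi_Q (x * y) = \pi_Q x * \pi_Q y.
Proof. exact: pi_quotient_mul. Qed.

Lemma pi_quotient_continuous : continuous (\pi_Q : G -> Q).
Proof. exact: pi_continuous. Qed.

Lemma open_quotientE (U : set Q) : open U = open (\pi_Q @^-1` U).
Proof. by []. Qed.

Let mulgl_continuous (h : G) : continuous (fun x : G => x * h).
Proof.
move=> x; apply: (continuous_comp (f := fun x : G => (x, h))
  (g := fun p : G * G => p.1 * p.2)); last exact: mulg_continuous.
by apply: cvg_pair; [exact: cvg_id|exact: cvg_cst].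
Qed.

Lemma pi_quotient_open (U : set G) : open U -> open (\pi_Q @` U).
Proof.
move=> oU; rewrite open_quotientE.
have -> : \pi_Q @^-1` (\pi_Q @` U) =
    \bigcup_(h in [set` H]) ((fun x : G => x * h) @^-1` U).
  apply/seteqP; split => [x [y Uy /eqmodP yx]|x [h /= Hh Uxh]].
    exists (x^-1 * y); last by rewrite /= mulgA mulgV mul1g.
    by rewrite /= -gpredV invgM invgK.
  by exists (x * h) => //; apply: eq_pi; rewrite /coset_rel invgM mulgVK gpredV.
apply: bigcup_open => h _.
by have /continuousP := @mulgl_continuous h; apply.
Qed.

Lemma quotient_mulg_continuous : continuous (fun p : Q * Q => p.1 * p.2).
Proof.
move=> [u v]; move: u v; elim/quotW => x; elim/quotW => y A.
rewrite /= -pi_mulg => nA.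
have /(mulg_continuous (x, y))[[B C] /= [nB nC] sBC] :=
  pi_quotient_continuous nA.
exists (\pi_Q @` (B°)%classic, \pi_Q @` (C°)%classic) => /=.
  split; apply: open_nbhs_nbhs; split.
  - by apply: pi_quotient_open; exact: open_interior.
  - by exists x.
  - by apply: pi_quotient_open; exact: open_interior.
  - by exists y.
move=> [_ _] [/= [a Ba <-] [b Cb <-]]; rewrite /= -pi_mulg.
by apply: (sBC (a, b)); split => /=; exact: interior_subset.
Qed.

HB.instance Definition _ :=
  PreTopologicalGroup_isParatopological.Build Q quotient_mulg_continuous.

End QuotientGroup.

(* Main.v *)
(* Write q for the projection of G onto G/H. The quotient of the topological
   group G^flat by H is a topological group whose topology is coarser than
   that of G/H; by maximality of the reflexion, q is open from G^flat to
   (G/H)^flat, and it is continuous by the universal property. Hence H is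
   closed in G^flat iff the neutral element is closed in (G/H)^flat, i.e. iff
   the topological group (G/H)^flat is Hausdorff.
   For regularity, let K in H be compact, and let W be an open neighborhood of
   1 in G^flat such that the points of H in W^-1 W lie in K. If V is a
   flat-closed neighborhood of 1 in G contained in W, and w in W is a limit of
   products v h with v in V and h in H, then h stays in K, so that it clusters
   at some k in K, and w k^-1 is in V. Thus q(V) is relatively closed in q(W),
   and intersecting it with a closed neighborhood of 1 in (G/H)^flat contained
   in q(W) yields a flat-closed set. *)
From HB Require Import structures.
Require Import Defs.
From mathcomp Require Import all_boot all_classical topology.

Local Open Scope classical_set_scope.
Local Open Scope quotient_scope.
Local Open Scope group_scope.

(** The inclusion pushes a compact neighbourhood in the subspace forward, so that later arguments
    stay in the ambient group. *)
Lemma locally_compact_set_type (X : topologicalType) (A : set X) (x : X) :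
    locally_compact [set: set_type A] -> A x ->
  exists W K : set X,
    [/\ nbhs x W, compact K, K `<=` A & W `&` A `<=` K].
Proof.
move=> lcA Ax; have := lcA (exist _ x (mem_set Ax)) I.
rewrite withinET => -[U + [cU _]].
rewrite nbhsE => -[_ [[W oW <-] Wx] WU].
exists W, (set_val @` U); split.
- exact: open_nbhs_nbhs.
- apply: continuous_compact => //; apply: continuous_subspaceT.
  exact: initial_continuous.
- by move=> _ [y _ <-]; exact: set_valP.
- by move=> y [Wy Ay]; exists (exist _ y (mem_set Ay)) => //; exact: WU.
Qed.

Section TopologicalGroupTheory.
Variable T : topologicalGroupType.
Implicit Types (x y : T) (A B K S V : set T).

Lemma nbhs_mulg x y A : nbhs (x * y) A ->
  exists B C, [/\ nbhs x B, nbhs y C & forall b c, B b -> C c -> A (b * c)].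
Proof.
move=> /(mulg_continuous (x, y))[[B C] /= [nB nC] sBC].
by exists B, C; split=> // b c Bb Cc; apply: (sBC (b, c)).
Qed.

Lemma nbhs_mulVg x y A : nbhs (x^-1 * y) A ->
  exists B C, [/\ nbhs x B, nbhs y C & forall b c, B b -> C c -> A (b^-1 * c)].
Proof.
move=> /nbhs_mulg[B [C [nB nC sBC]]].
exists ((fun x => x^-1) @^-1` B), C; split => //; last by move=> b c; exact: sBC.
exact: (@invg_continuous T) nB.
Qed.

Lemma nbhs_mulgV x y A : nbhs (x * y^-1) A ->
  exists B C, [/\ nbhs x B, nbhs y C & forall b c, B b -> C c -> A (b * c^-1)].
Proof.
move=> /nbhs_mulg[B [C [nB nC sBC]]].
exists B, ((fun x => x^-1) @^-1` C); split => //; last by move=> b c Bb; exact: sBC.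
exact: (@invg_continuous T) nC.
Qed.

(** If [B C^-1] lies in [A], so does the closure of [B]: for [y] in that closure, some [z] in [B]
    has [y^-1 z] in [C]. *)
Lemma topological_group_regular : regular_space T.
Proof.
move=> x A nA.
have /nbhs_mulgV[B [C [nB nC sBC]]] : nbhs (x * 1^-1) A by rewrite invg1 mulg1.
exists B => // y clBy.
have /nbhs_mulVg[D [E [nD nE sDE]]] : nbhs (y^-1 * y) C by rewrite mulVg.
have [z [Bz Ez]] := clBy _ nE.
have -> : y = z * (y^-1 * z)^-1 by rewrite invgM invgK mulVKg.
by apply: sBC => //; apply: sDE => //; exact: nbhs_singleton.
Qed.

(** If [x] and [y] have no disjoint neighbourhoods, every neighbourhood of [x^-1 y] contains some
    [z^-1 z = 1]. *)
Lemma topological_group_hausdorff :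
  closed [set (1 : T)] -> hausdorff_space T.
Proof.
move=> cl1 x y clxy.
have /cl1/= : closure [set (1 : T)] (x^-1 * y).
  move=> A /nbhs_mulVg[B [C [nB nC sBC]]].
  have [z [Bz Cz]] := clxy _ _ nB nC.
  by exists 1; split => //; rewrite -(mulVg z); exact: sBC.
by move=> xy1; rewrite -[y](mulVKg x) xy1 mulg1.
Qed.

(** A local form of the fact that closed times compact is closed: compactness only has to control
    the second factors of products falling in [N]. *)
Lemma closure_mul_compact V S K N x :
    closed V -> compact K -> K `<=` S -> nbhs x N ->
    (forall v h, V v -> S h -> N (v * h) -> K h) ->
  closure [set v * h | v in V & h in S] x ->
  [set v * h | v in V & h in S] x.
Proof.
move=> clV cK KS nN NK clx.
(* The filter of second factors [h] of products [v h] close to [x]. *)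
pose F : set_system T := filter_from (nbhs x)
  (fun A => [set h | S h /\ exists2 v, V v & A (v * h)]).
have FF : ProperFilter F.
  apply: filter_from_proper; last first.
    by move=> A /clx[_ [[v Vv [h Sh <-]] Avh]]; exists h; split => //; exists v.
  apply: filter_from_filter; first by exists setT; exact: filterT.
  move=> A B nA nB; exists (A `&` B); first exact: filterI.
  by move=> h [Sh [v Vv [Avh Bvh]]]; do 2!split => //; exists v.
have FK : F K by exists N => // h [Sh [v Vv Nvh]]; exact: NK Nvh.
have [k [Kk clk]] := cK F FF FK.
(* [x k^-1] is adherent to [V], since [v = (v h) h^-1] with [v h] near [x] and [h] near [k]. *)
exists (x * k^-1); last by exists k; [exact: KS|rewrite mulgVK].
apply: clV => A /nbhs_mulgV[B [C [nB nC sBC]]].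
have FB : F [set h | S h /\ exists2 v, V v & B (v * h)] by exists B.
have [h [[Sh [v Vv Bvh]] Ch]] := clk _ _ FB nC.
by exists v; split => //; rewrite -(mulgK h v); exact: sBC.
Qed.

End TopologicalGroupTheory.

Lemma nbhs_flat (G : paratopologicalGroupType) (x : G) (A : set G) :
  nbhs (x : flat G) A -> nbhs x A.
Proof.
rewrite nbhsE => -[B [oB Bx] BA]; rewrite nbhsE.
by exists B => //; split => //; exact: flat_coarser.
Qed.

Lemma flat_regularP (G : paratopologicalGroupType) :
  flat_regular G <-> forall U : set G, nbhs 1 U ->
    exists V : set G, [/\ flat_closed V, nbhs 1 V & V `<=` U].
Proof.
split=> [[B [Bcl Bnbhs]] U|regG].
  rewrite Bnbhs => -[V BV VU]; exists V; split => //; first exact: Bcl.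
  by exists V.
exists [set V : set G | flat_closed V /\ nbhs 1 V]; split=> [V []//|].
apply/seteqP; split=> [U /regG[V [clV nV VU]]|U [V [_ nV] VU]].
  by exists V.
exact: filterS VU nV.
Qed.

Lemma quotient_invg_continuous (T : topologicalGroupType)
  (H : normalClosed T) : continuous (fun x : quotient_group H => x^-1).
Proof.
pose Q := quotient_group H.
apply/quotient_continuous.
have -> : (fun x : Q => x^-1) \o \pi_Q = \pi_Q \o (fun x : T => x^-1).
  by apply/funext => x /=; rewrite pi_quotient_inv.
move=> x; apply: continuous_comp; first exact: invg_continuous.
exact: pi_quotient_continuous.
Qed.

Section FlatQuotient.
Variables (G : paratopologicalGroupType) (H : normalClosed G).
Local Notation Q := (quotient_group H).

Lemma pi_quotient_eq1 (x : G) : \pi_Q x = 1 <-> x \in H.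
Proof.
have pi1 : \pi_Q 1 = 1 :> Q by [].
by rewrite -pi1; split=> [/esym/eqmodP|Hx]; [|apply/esym/eqmodP];
  rewrite /= /coset_rel invg1 mul1g.
Qed.

Lemma flat_pi_continuous : continuous (\pi_Q : flat G -> flat Q).
Proof.
pose f : G -> flat Q := \pi_Q.
pose fM := isMultiplicative.Build G (flat Q) f (@pi_mulg G H).
pose F : {multiplicative G -> flat Q} := HB.pack f fM.
apply: (@flat_universal G (flat Q) F) => x A /nbhs_flat.
exact: pi_quotient_continuous.
Qed.

Lemma flat_pi_open (U : set G) :
  open (U : set (flat G)) -> open (\pi_Q @` U : set (flat Q)).
Proof.
(* [flat G] has the group law of [G], so [QF] is the group [Q] with another topology, a competitor
   for the reflexion of [Q]. *)
pose HF : normalClosed (flat G) := H.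
pose QF := quotient_group HF.
pose t : Topological Q := Topological.on QF.
have gt : is_group_topology t.
  split; first exact: (@quotient_mulg_continuous _ HF).
  exact: (@quotient_invg_continuous _ HF).
have ct : coarser_topology t by move=> A; exact: flat_coarser.
by move=> oU; apply: (flat_strongest gt ct); exact: (@pi_quotient_open _ HF).
Qed.

Lemma quotient_flat_regular :
  flat_regular G -> flat_locally_compact [set` H] -> flat_regular Q.
Proof.
move=> /flat_regularP regG lcH; apply/flat_regularP => U nU.
have [A [K [nA cK KH AHK]]] :=
  @locally_compact_set_type (flat G) [set` H] 1 lcH (gpred1 (s := H)).
have [W1 [W2 [nW1 nW2 WA]]] : exists B C : set (flat G),
    [/\ nbhs 1 B, nbhs 1 C & forall b c, B b -> C c -> A (b^-1 * c)].
  by apply: nbhs_mulVg; rewrite mulVg.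
pose W := ((W1 `&` W2) : set (flat G))°%classic.
have WW12 : W `<=` W1 `&` W2 := @interior_subset (flat G) _.
have oW : open (W : set (flat G)) := @open_interior (flat G) _.
have W1G : W 1 by rewrite /W /interior; exact: filterI.
have nWQ : nbhs (1 : flat Q) (\pi_Q @` W).
  by apply: open_nbhs_nbhs; split; [exact: flat_pi_open|exists 1].
have [C nC clCW] := @topological_group_regular (flat Q) 1 _ nWQ.
have [V [clV nV VUW]] : exists V : set G,
    [/\ flat_closed V, nbhs 1 V & V `<=` \pi_Q @^-1` U `&` W].
  apply: regG; apply: filterI; first exact: pi_quotient_continuous.
  by apply: nbhs_flat; apply: open_nbhs_nbhs; split.
have piV_closed w : closure (\pi_Q @` V : set (flat Q)) (\pi_Q w) -> W w ->
    (\pi_Q @` V) (\pi_Q w).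
  move=> clw Ww.
  suff [v Vv [h Hh <-]] : [set v * h | v in V & h in [set` H]] w.
    exists v => //; rewrite pi_mulg.
    by rewrite (proj2 (pi_quotient_eq1 h) Hh) mulg1.
  apply: (@closure_mul_compact (flat G) V [set` H] K W w) => //.
  - exact: open_nbhs_nbhs.
  - move=> v h Vv Hh Wvh; apply: AHK; split => //.
    (* Write [h = v^-1 (v h)] with [v] in [W1] and [v h] in [W2]. *)
    rewrite -(mulKg v h); apply: WA; last by have [] := WW12 _ Wvh.
    by have [_ /WW12[]] := VUW _ Vv.
  - move=> B nB.
    (* Openness of the projection lifts adherence back to [G]: some [b] in [B] is congruent to an
       element of [V]. *)
    have nQ : nbhs (\pi_Q w : flat Q) (\pi_Q @` ((B : set (flat G))°%classic)).
      apply: open_nbhs_nbhs; split; last by exists w.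
      by apply: flat_pi_open; exact: open_interior.
    have [_ [[v Vv <-] [b Bb /eqmodP vb]]] := clw _ nQ.
    exists b; split; last exact: (@interior_subset (flat G)).
    exists v => //; exists (v^-1 * b); last by rewrite mulVKg.
    by rewrite /= -gpredV invgM invgK.
exists (\pi_Q @` V `&` closure (C : set (flat Q))); split.
(* [p] lies in the closure of [C], hence has a representative in [W], to which [piV_closed]
   applies. *)
- move=> p /closureI[clVp clCp]; have {}clCp := closed_closure clCp.
  split => //; have [w Ww wp] := clCW _ clCp.
  by rewrite -wp in clVp *; exact: piV_closed.
- apply: filterI; last first.
    by apply: nbhs_flat; apply: filterS nC; exact: subset_closure.
  (* The interior is taken in [G], not in [flat G]: [V] is a neighbourhood of 1 only in the original
     topology. *)
  rewrite nbhsE; exists (\pi_Q @` (V°)%classic).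
    by split; [apply: pi_quotient_open; exact: open_interior|exists 1].
  by apply: image_subset; exact: interior_subset.
- by move=> _ [[v Vv <-] _]; have [] := VUW _ Vv.
Qed.

End FlatQuotient.

Theorem theorem1 (G : paratopologicalGroupType) (H : normalClosed G) :
  flat_separated G ->
  (flat_separated (quotient_group H) <-> flat_closed [set` H]) /\
  (flat_regular G ->
   flat_locally_compact [set` H] ->
   flat_regular (quotient_group H)).
Proof.
move=> _; split; first split => [hQ|clH].
- have cl1 : closed [set (1 : flat (quotient_group H))].
    exact/accessible_closed_set1/hausdorff_accessible.
  have piH : [set` H] = \pi_(quotient_group H) @^-1` [set 1].
    by apply/seteqP; split=> x /=; rewrite pi_quotient_eq1.
  rewrite /flat_closed piH; apply: (@preimage_closed (flat G)) cl1.
  by move=> x _; exact: flat_pi_continuous.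
- apply: topological_group_hausdorff; rewrite -openC.
  have -> : ~` [set (1 : flat (quotient_group H))] =
      \pi_(quotient_group H) @` (~` [set` H]).
    apply/seteqP; split=> [|_ [x xH <-] /pi_quotient_eq1//].
    elim/quotW => x x1; exists x => // xH.
    by apply: x1; exact/pi_quotient_eq1.
  by apply: flat_pi_open; rewrite openC.
exact: quotient_flat_regular.
Qed.
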